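(* For every $q\in[1,\infty]$ and all $\mathbf{h},\mathbf{g}\in\mathbb{R}^{S\times K}_*$, $$\|P(\mathbf{h})-P(\mathbf{g})\|_q\leq S^{\frac{K-1}{q}}\,K^{1-\frac1q}\,\max\left(\|P(\mathbf{h})\|_\infty^{1-\frac1K},\|P(\mathbf{g})\|_\infty^{1-\frac1K}\right)d_q(\langle\mathbf{h}\rangle,\langle\mathbf{g}\rangle).$$
   Context: Let $K\geq 1$ and $S\geq 2$ be integers, $[K]=\{1,\dots,K\}$, $[S]=\{1,\dots,S\}$. An element $\mathbf{h}\in\mathbb{R}^{S\times K}$ is a $K$-tuple of vectors $\mathbf{h}_1,\dots,\mathbf{h}_K\in\mathbb{R}^S$; the $i$-th entry of $\mathbf{h}_k$ is $\mathbf{h}_{k,i}$. $\mathbb{R}^{S^K}$ is the space of real order-$K$ tensors $T=(T_{\mathbf{i}})_{\mathbf{i}\in[S]^K}$. $\|\cdot\|_q$ is the usual entrywise $\ell^q$ norm on $\mathbb{R}^{S\times K}$ and on $\mathbb{R}^{S^K}$ (max of absolute values if $q=\infty$); expressions of the form $a/\infty$ equal $0$. The Segre embedding is $P:\mathbb{R}^{S\times K}\to\mathbb{R}^{S^K}$, $P(\mathbf{h})_{\mathbf{i}}=\mathbf{h}_{1,i_1}\mathbf{h}_{2,i_2}\cdots\mathbf{h}_{K,i_K}$ for $\mathbf{i}=(i_1,\dots,i_K)\in[S]^K$. Set $\mathbb{R}^{S\times K}_*=\{\mathbf{h}\in\mathbb{R}^{S\times K} : \mathbf{h}_k\neq 0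 \ \forall k\in[K]\}$. On $\mathbb{R}^{S\times K}_*$ define the equivalence relation: $\mathbf{h}\sim\mathbf{g}$ iff there exist $\lambda_1,\dots,\lambda_K\in\mathbb{R}$ with $\prod_{k=1}^K\lambda_k=1$ and $\mathbf{h}_k=\lambda_k\mathbf{g}_k$ for all $k\in[K]$. The class of $\mathbf{h}$ is denoted $\langle\mathbf{h}\rangle$. Set $\mathbb{R}^{S\times K}_{\rm diag}=\{\mathbf{h}\in\mathbb{R}^{S\times K}_* : \|\mathbf{h}_k\|_\infty=\|\mathbf{h}_1\|_\infty\ \forall k\in[K]\}$. For $q\in[1,\infty]$ and $\mathbf{h},\mathbf{g}\in\mathbb{R}^{S\times K}_*$, $$d_q(\langle\mathbf{h}\rangle,\langle\mathbf{g}\rangle)=\inf\{\|\mathbf{h}'-\mathbf{g}'\|_q : \mathbf{h}'\in\langle\mathbf{h}\rangle\cap\mathbb{R}^{S\times K}_{\rm diag},\ \mathbf{g}'\in\langle\mathbf{g}\rangle\cap\mathbb{R}^{S\times K}_{\rm diag}\}.$$ *)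

(* Defs.v *)
From mathcomp Require Import all_boot all_order all_algebra.
From mathcomp Require Import all_classical all_reals all_analysis.

Set Implicit Arguments.
Unset Strict Implicit.
Unset Printing Implicit Defensive.

Import Order.TTheory GRing.Theory Num.Theory.

Local Open Scope classical_set_scope.
Local Open Scope ring_scope.

(* Indices are numbered from 0.  An element h of R^{S x K} is an S x K matrix
   whose column k is the vector h_k, so that h i k is the i-th entry of h_k. *)

Notation tensor R S K := {ffun {ffun 'I_K -> 'I_S} -> R}.

(* Only used for 1 <= q; the value at q = -oo is junk. *)
Definition lq_norm (R : realType) (I : finType) (q : \bar R) (x : I -> R) : R :=
  match q with
  | r%:E => (\sum_i `|x i| `^ r) `^ r^-1
  | +oo%E => \big[Num.max/0]_i `|x i|
  | -oo%E => 0
  end.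

Definition mx_lq_norm (R : realType) (S K : nat) (q : \bar R)
    (h : 'M[R]_(S, K)) : R :=
  lq_norm q (fun ik : 'I_S * 'I_K => h ik.1 ik.2).

Definition tensor_lq_norm (R : realType) (S K : nat) (q : \bar R)
    (T : tensor R S K) : R :=
  lq_norm q (fun i : {ffun 'I_K -> 'I_S} => T i).

Definition segre (R : realType) (S K : nat) (h : 'M[R]_(S, K)) : tensor R S K :=
  [ffun i : {ffun 'I_K -> 'I_S} => \prod_k h (i k) k].

Definition star (R : realType) (S K : nat) : set 'M[R]_(S, K) :=
  [set h | forall k, col k h != 0].

Definition segre_equiv (R : realType) (S K : nat) (h g : 'M[R]_(S, K)) : Prop :=
  exists lambda : 'I_K -> R,
    \prod_k lambda k = 1 /\ forall k, col k h = lambda k *: col k g.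

Definition segre_class (R : realType) (S K : nat) (h : 'M[R]_(S, K)) :
    set 'M[R]_(S, K) :=
  [set h' | star h' /\ segre_equiv h' h].

Definition col_sup_norm (R : realType) (S K : nat) (h : 'M[R]_(S, K))
    (k : 'I_K) : R :=
  lq_norm +oo%E (fun i => h i k).

(* k1 is the index of the first vector of the tuple. *)
Definition diag (R : realType) (S K : nat) : set 'M[R]_(S, K) :=
  [set h | star h /\
    forall k k1 : 'I_K, k1 = 0%N :> nat -> col_sup_norm h k = col_sup_norm h k1].

(* The arguments A and B are meant to be equivalence classes. *)
Definition class_dist (R : realType) (S K : nat) (q : \bar R)
    (A B : set 'M[R]_(S, K)) : R :=
  inf [set d | exists h' g' : 'M[R]_(S, K),
    [/\ (A `&` @diag R S K) h', (B `&` @diag R S K) g'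
      & d = mx_lq_norm q (h' - g')]].

(* Main.v *)
(* P is constant on classes, so h and g may be replaced by diagonal
   representatives h' and g'.  All columns of h' then have sup norm
   ||P(h)||_oo^(1/K), and likewise for g', so that telescoping the product gives,
   with M the larger of the two,
   |P(h)_i - P(g)_i| <= M^(K-1) sum_k |h'_(k,i_k) - g'_(k,i_k)|.
   Convexity of t |-> t^q costs the factor K^(q-1) when the sum is raised to the
   power q, and summing over i counts each entry (k,s) exactly S^(K-1) times.
   Every class has a diagonal representative, so the infimum is not the junk
   value inf set0 = 0. *)

Require Import Defs.
From mathcomp Require Import all_boot all_order all_algebra.
From mathcomp Require Import all_classical all_reals all_analysis.
From mathcomp Require Import ring.

Import Order.TTheory GRing.Theory Num.Theory.

Local Open Scope classical_set_scope.
Local Open Scope ring_scope.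

(** Jensen's inequality for [t ^ p], deduced by induction from convexity at two points. For [n = 0]
    both sides are 0, division by 0 giving 0. *)
Lemma powR_mean_le (R : realType) (p : R) (n : nat) (x : 'I_n -> R) :
  1 <= p -> (forall i, 0 <= x i) ->
  ((\sum_i x i) / n%:R) `^ p <= (\sum_i x i `^ p) / n%:R.
Proof.
move=> p1; elim: n x => [|n IH] x x0.
  by rewrite !big_ord0 !mul0r powR0 // gt_eqF // (lt_le_trans ltr01 p1).
rewrite !big_ord_recr /=.
(* A single term is treated apart: the weights below divide by the number of earlier terms, which
   must be nonzero. *)
case: n => [|n] in IH x x0 *.
  by rewrite !big_ord0 !add0r !divr1.
set y := fun i : 'I_n.+1 => x (widen_ord (leqnSn n.+1) i).
have y0 i : 0 <= y i by exact: x0.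
have {}IH := IH y y0.
rewrite -/(\sum_(i < n.+1) y i) -/(\sum_(i < n.+1) y i `^ p).
set s := \sum_i y i in IH *; set s' := \sum_i y i `^ p in IH *.
set z := x ord_max.
have s0 : 0 <= s by apply: sumr_ge0.
have N0 : n.+1%:R != 0 :> R by rewrite pnatr_eq0.
have N1 : n.+2%:R != 0 :> R by rewrite pnatr_eq0.
have t0 : 0 <= n.+1%:R / n.+2%:R :> R by rewrite divr_ge0.
have t1 : n.+1%:R / n.+2%:R <= 1 :> R.
  by rewrite ler_pdivrMr ?ltr0n // mul1r ler_nat.
have t1E : 1 - n.+1%:R / n.+2%:R = n.+2%:R^-1 :> R.
  by rewrite -{1}(divff N1) -mulrBl -natrB // subSnn mul1r.
(* The mean of [n.+2] terms is the mean of the first [n.+1] with weight [n.+1 / n.+2], plus the last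
   term with weight [1 / n.+2]. *)
have weighE u v :
    (u + v) / n.+2%:R = n.+1%:R / n.+2%:R * (u / n.+1%:R) + n.+2%:R^-1 * v :> R.
  by rewrite mulrDl [v / _]mulrC [X in _ = X + _]mulrC mulrA divfK.
have inR u : 0 <= u -> u \in (`[0, +oo[%classic : set R).
  by move=> u0; rewrite inE /= in_itv /= u0.
have := convex_powR p1 (Itv01 t0 t1)
  (inR _ (divr_ge0 s0 (ler0n R n.+1))) (inR _ (x0 ord_max)).
rewrite convRE [X in X `^ _ <= _ -> _]convRE /unstable.onem /= -/z t1E => H.
rewrite !weighE; apply: le_trans H _.
by rewrite lerD2r ler_wpM2l.
Qed.

(** The sum is [n] times the mean; of the factor [n ^ p], one power of [n] cancels the denominator
    in Jensen's inequality. *)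
Lemma powR_sum_le (R : realType) (p : R) (n : nat) (x : 'I_n -> R) :
  1 <= p -> (forall i, 0 <= x i) ->
  (\sum_i x i) `^ p <= n%:R `^ (p - 1) * \sum_i x i `^ p.
Proof.
move=> p1 x0; have p0 : 0 < p by exact: lt_le_trans ltr01 p1.
case: n x x0 => [|n] x x0.
  by rewrite !big_ord0 mulr0 powR0 // gt_eqF.
have s0 : 0 <= \sum_i x i by apply: sumr_ge0.
have N0 : n.+1%:R != 0 :> R by rewrite pnatr_eq0.
rewrite -[X in X `^ p <= _](divfK N0) powRM ?divr_ge0 //.
rewrite -(mulr_powRB1 (ler0n R n.+1) p0) mulrA [leRHS]mulrC.
rewrite ler_wpM2r ?powR_ge0 // -ler_pdivlMr ?ltr0n //.
exact: powR_mean_le.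
Qed.

Lemma prodB_le (R : realDomainType) (n : nat) (x y : 'I_n -> R) (M : R) :
  (forall i, `|x i| <= M) -> (forall i, `|y i| <= M) ->
  `|\prod_i x i - \prod_i y i| <= M ^+ n.-1 * \sum_i `|x i - y i|.
Proof.
elim: n x y => [|n IH] x y xM yM.
  by rewrite !big_ord0 subrr normr0 mulr0.
have M0 : 0 <= M by rewrite (le_trans _ (xM ord0)).
rewrite !big_ord_recl /=.
set X := \prod_(i < n) x _; set Y := \prod_(i < n) y _.
have -> : x ord0 * X - y ord0 * Y = (x ord0 - y ord0) * X + y ord0 * (X - Y) by ring.
rewrite [leRHS]mulrDr (le_trans (ler_normD _ _)) // !normrM lerD //.
  rewrite mulrC ler_wpM2r // /X normr_prod.
  rewrite (le_trans (ler_prod _ (E2 := fun=> M) _)) //.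
    by move=> i _; rewrite normr_ge0 xM.
  by rewrite prodr_const card_ord.
have {}IH : `|X - Y| <= _ := IH _ _ (fun i => xM (lift ord0 i)) (fun i => yM (lift ord0 i)).
(* With no factors left, [M * M ^+ n.-1] is not [M ^+ n], but then [X] and [Y] are both 1. *)
case: n => [|n] in x y xM yM X Y IH *.
  by rewrite /X /Y !big_ord0 subrr normr0 !mulr0.
by rewrite exprS -mulrA ler_pM.
Qed.

Section SupNorm.
Variables (R : realType) (I : finType).
Implicit Types x : I -> R.

Lemma sup_norm_ge x i : `|x i| <= lq_norm +oo%E x.
Proof. exact: (le_bigmax 0 (fun i => `|x i|)). Qed.

Lemma sup_norm_le x (c : R) :
  0 <= c -> (forall i, `|x i| <= c) -> lq_norm +oo%E x <= c.
Proof. by move=> c0 xc; apply: bigmax_le. Qed.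

Lemma sup_norm_ge0 x : 0 <= lq_norm +oo%E x.
Proof. exact: bigmax_ge_id. Qed.

Lemma sup_norm_attained (i0 : I) x : exists i, lq_norm +oo%E x = `|x i|.
Proof.
have [i _ xi] := @eq_bigmax _ _ _ 0 i0 predT (fun i => `|x i|) isT
  (fun i _ => normr_ge0 (x i)).
by exists i.
Qed.

End SupNorm.

Section Segre.
Variables (R : realType) (S K : nat).
Implicit Types h g : 'M[R]_(S, K).

Lemma col_sup_norm_gt0 h k : star h -> 0 < col_sup_norm h k.
Proof.
move=> hh; rewrite lt_neqAle sup_norm_ge0 andbT eq_sym.
apply: contraNN (hh k) => /eqP n0; apply/eqP/colP => i; rewrite !mxE.
by apply/normr0_eq0/eqP; rewrite eq_le normr_ge0 andbT -n0 (sup_norm_ge _ _ (fun i => h i k)).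
Qed.

Lemma segre_equiv_segre h g : segre_equiv h g -> segre h = segre g.
Proof.
move=> [l [l1 hE]]; apply/ffunP => i; rewrite !ffunE.
rewrite -[RHS]mul1r -[X in _ = X * _]l1 -big_split /=; apply: eq_bigr => k _.
by have /colP/(_ (i k)) := hE k; rewrite !mxE.
Qed.

Lemma segre_sup_norm h : (0 < S)%N ->
  tensor_lq_norm +oo%E (segre h) = \prod_k col_sup_norm h k.
Proof.
move=> S0; apply/eqP; rewrite eq_le; apply/andP; split.
  apply: sup_norm_le => [|i].
    by apply: prodr_ge0 => k _; apply: sup_norm_ge0.
  rewrite ffunE normr_prod; apply: ler_prod => k _.
  by rewrite normr_ge0 (sup_norm_ge _ _ (fun i => h i k)).
(* The bound is attained at the multi-index that picks an entry of largest modulus in each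
   column. *)
have /choice[f fE] k : exists i, col_sup_norm h k = `|h i k|.
  exact: (sup_norm_attained _ _ (Ordinal S0) (fun i => h i k)).
rewrite (eq_bigr (fun k => `|h (f k) k|)) // -normr_prod.
have := sup_norm_ge _ _ (segre h) [ffun k => f k].
by rewrite ffunE; under eq_bigr do rewrite ffunE.
Qed.

(** Each column is rescaled so that its sup norm becomes [m], the geometric mean of all the column
    norms; the factors [m / n k] then multiply to 1. *)
Lemma exists_diag_representative h : (0 < K)%N -> star h ->
  exists h', (segre_class h `&` @diag R S K) h'.
Proof.
move=> K0 hh; set n := col_sup_norm h.
have n0 k : 0 < n k by exact: col_sup_norm_gt0.
have P0 : 0 < \prod_k n k by apply: prodr_gt0.
set m := (\prod_k n k) `^ K%:R^-1.
have m0 : 0 < m by rewrite powR_gt0.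
have mK : m ^+ K = \prod_k n k.
  by rewrite -powR_mulrn ?ltW // -powRrM mulVf ?pnatr_eq0 -?lt0n // powRr1 // ltW.
pose h' : 'M[R]_(S, K) := \matrix_(i, k) (m / n k * h i k).
have colE k : col k h' = (m / n k) *: col k h by apply/colP => i; rewrite !mxE.
have l0 k : 0 < m / n k by rewrite divr_gt0.
have hh' : star h' by move=> k; rewrite colE scaler_eq0 negb_or hh gt_eqF ?l0.
have nE k : col_sup_norm h' k = m.
  have mnE i : `|h' i k| = m / n k * `|h i k| by rewrite mxE normrM gtr0_norm.
  have mE : m = m / n k * n k by rewrite divfK // gt_eqF.
  apply/eqP; rewrite eq_le; apply/andP; split.
    apply: sup_norm_le => [|i]; first exact: ltW.
    by rewrite mnE {2}mE ler_pM2l // (sup_norm_ge _ _ (fun i => h i k)).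
  (* If [S] were 0, the sup norm of a column would be the default 0, against [n0]. *)
  have [i0 _|/(_ _) none] := pickP (@predT 'I_S); last first.
    by have := n0 k; rewrite /n /col_sup_norm /= big_pred0 ?ltxx.
  have [i iE] := sup_norm_attained _ _ i0 (fun i => h i k).
  have nkE : n k = `|h i k| by exact: iE.
  rewrite mE {2}nkE -mnE.
  exact: (sup_norm_ge _ _ (fun i => h' i k)).
exists h'; split; last by split=> // k k1 _; rewrite !nE.
split=> //; exists (fun k => m / n k); split=> //.
rewrite big_split /= prodr_const card_ord mK prodfV divff //.
by rewrite gt_eqF.
Qed.

Lemma sum_multi_index (F : 'I_S -> R) (k : 'I_K) :
  \sum_(i : {ffun 'I_K -> 'I_S}) F (i k) = S%:R ^+ K.-1 * \sum_s F s.
Proof.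
(* [F (i k)] is written as a product over all columns, with factor 1 off [k], so that the sum
   factors by distributivity; each of the other [K.-1] columns contributes [S]. *)
pose G k' s := if k' == k then F s else 1.
rewrite (eq_bigr (fun i : {ffun 'I_K -> 'I_S} => \prod_k' G k' (i k'))).
  rewrite -bigA_distr_bigA (bigD1 k) //= mulrC; congr (_ * _); last first.
    by apply: eq_bigr => s _; rewrite /G eqxx.
  rewrite (eq_bigr (fun=> S%:R)).
    by rewrite prodr_const cardC1 card_ord.
  move=> k' /negPf k'k; rewrite /G k'k.
  by rewrite sumr_const card_ord.
move=> i _; rewrite (bigD1 k) //= /G eqxx big1 ?mulr1 //.
by move=> k' /negPf ->.
Qed.

Lemma mx_lq_norm_ge0 (q : \bar R) h : 0 <= mx_lq_norm q h.
Proof.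
case: q => [r||] //; first exact: powR_ge0.
exact: bigmax_ge_id.
Qed.

(** Isolates the passage from an entrywise bound to norms; it is later applied with [d] a difference
    of diagonal representatives and [c] a power of their larger column norm. *)
Lemma tensor_lq_norm_le (q : \bar R) (T : tensor R S K) (d : 'M[R]_(S, K)) (c : R) :
  (0 < K)%N -> (1 <= q)%E -> 0 <= c ->
  (forall i, `|T i| <= c * \sum_k `|d (i k) k|) ->
  tensor_lq_norm q T <=
    S%:R `^ ((K%:R - 1) * fine (q^-1)%E) * K%:R `^ (1 - fine (q^-1)%E) * c
      * mx_lq_norm q d.
Proof.
move=> K0 q1 c0 Td; case: q q1 => [r||] q1; last by [].
- rewrite lee_fin in q1; have r0 : 0 < r by exact: lt_le_trans ltr01 q1.
  rewrite fine_invr /tensor_lq_norm /mx_lq_norm /lq_norm.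
  have -> : K%:R - 1 = K.-1%:R :> R by rewrite -[in LHS](prednK K0) -addn1 natrD addrK.
  set D := \sum_(i : 'I_S * 'I_K) _.
  have D0 : 0 <= D by apply: sumr_ge0 => i _; exact: powR_ge0.
  have H : \sum_i `|T i| `^ r <= S%:R ^+ K.-1 * K%:R `^ (r - 1) * c `^ r * D.
    have Ti i : `|T i| `^ r <= c `^ r * (K%:R `^ (r - 1) * \sum_k `|d (i k) k| `^ r).
      have s0 : 0 <= \sum_k `|d (i k) k| by apply: sumr_ge0.
      apply: (@le_trans _ _ ((c * \sum_k `|d (i k) k|) `^ r)).
        by rewrite ge0_ler_powR ?nnegrE ?(ltW r0) // mulr_ge0.
      rewrite powRM // ler_wpM2l ?powR_ge0 //.
      exact: (powR_sum_le _ _ _ (fun k => `|d (i k) k|)).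
    rewrite (le_trans (ler_sum _ (fun i _ => Ti i))) // -!mulr_sumr exchange_big /=.
    under eq_bigr => k _ do rewrite (sum_multi_index (fun s => `|d s k| `^ r)).
    rewrite -mulr_sumr exchange_big /= pair_big /= -/D.
    by rewrite le_eqVlt; apply/orP; left; apply/eqP; ring.
  apply: (le_trans (ge0_ler_powR _ _ _ H)).
  + by rewrite invr_ge0 ltW.
  + by rewrite nnegrE; apply: sumr_ge0 => i _; exact: powR_ge0.
  + by rewrite nnegrE !mulr_ge0 ?powR_ge0 ?exprn_ge0.
  (* The root of order [r] gives [S] the exponent [K.-1 / r] and [K] the exponent
     [(r - 1) / r = 1 - 1 / r]. *)
  rewrite !powRM ?mulr_ge0 ?powR_ge0 ?exprn_ge0 //.
  rewrite -powR_mulrn // -!powRrM mulfV ?gt_eqF // powRr1 //.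
  by rewrite mulrBl mulfV ?gt_eqF // mul1r.
(* For [q = +oo] the inverse is 0 and the constant reduces to [K * c]: each of the [K] terms is at
   most the sup norm of [d]. *)
rewrite invey /= mulr0 subr0 powRr0 mul1r powRr1 //.
have m0 := mx_lq_norm_ge0 +oo%E d.
apply: sup_norm_le => [|i]; first by rewrite !mulr_ge0.
rewrite (le_trans (Td i)) // [K%:R * c]mulrC -mulrA ler_wpM2l //.
rewrite (le_trans (ler_sum _ (fun k _ => sup_norm_ge _ _
  (fun ik : 'I_S * 'I_K => d ik.1 ik.2) (i k, k)))) //.
by rewrite sumr_const card_ord mulr_natl.
Qed.

Lemma segre_sup_norm_diag h k : (0 < K)%N -> (0 < S)%N -> diag h ->
  tensor_lq_norm +oo%E (segre h) `^ (1 - K%:R^-1) = col_sup_norm h k ^+ K.-1.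
Proof.
move=> K0 S0 [_ dh]; rewrite segre_sup_norm //.
rewrite (eq_bigr (fun=> col_sup_norm h k)); last first.
  by move=> k' _; rewrite (dh k' (Ordinal K0)) // -(dh k).
have n0 : 0 <= col_sup_norm h k by exact: sup_norm_ge0.
rewrite prodr_const card_ord -!powR_mulrn // -powRrM mulrBr mulr1 mulfV.
  by congr powR; rewrite -[in LHS](prednK K0) -addn1 natrD addrK.
by rewrite pnatr_eq0 -lt0n.
Qed.

End Segre.

Theorem theorem4p5 (R : realType) (K S : nat) (hK : (1 <= K)%N) (hS : (2 <= S)%N)
    (q : \bar R) (hq : (1 <= q)%E) (h g : 'M[R]_(S, K))
    (hh : star h) (hg : star g) :
  tensor_lq_norm q (segre h - segre g) <=
    S%:R `^ ((K%:R - 1) * fine (q^-1)%E) * K%:R `^ (1 - fine (q^-1)%E) *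
    Num.max (tensor_lq_norm +oo%E (segre h) `^ (1 - K%:R^-1))
            (tensor_lq_norm +oo%E (segre g) `^ (1 - K%:R^-1)) *
    class_dist q (segre_class h) (segre_class g).
Proof.
have S0 : (0 < S)%N by exact: ltnW.
set c := _ * Num.max _ _.
(* Positivity allows division by [c], so that the claim becomes a lower bound for every element of
   the set whose infimum is taken. *)
have c0 : 0 < c.
  rewrite !mulr_gt0 ?powR_gt0 ?ltr0n // lt_max powR_gt0 //.
  by rewrite segre_sup_norm // prodr_gt0 // => k _; exact: col_sup_norm_gt0.
rewrite -ler_pdivrMl //; apply: lb_le_inf.
  have [h' hh'] := exists_diag_representative _ _ _ _ hK hh.
  have [g' hg'] := exists_diag_representative _ _ _ _ hK hg.
  by exists (mx_lq_norm q (h' - g')), h', g'.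
move=> _ [h' [g' [[[_ hh'] dh'] [[_ hg'] dg'] ->]]].
rewrite ler_pdivrMl // /c -(segre_equiv_segre _ _ _ _ _ hh') -(segre_equiv_segre _ _ _ _ _ hg').
pose k0 := Ordinal hK.
rewrite !(segre_sup_norm_diag _ _ _ _ k0) //.
set a := col_sup_norm h' k0; set b := col_sup_norm g' k0.
have a0 : 0 <= a by exact: sup_norm_ge0.
have b0 : 0 <= b by exact: sup_norm_ge0.
(* Powers are monotone on nonnegative reals, so the maximum moves inside and [Num.max a b] bounds
   all entries of both representatives. *)
have -> : Num.max (a ^+ K.-1) (b ^+ K.-1) = Num.max a b ^+ K.-1.
  case: (leP a b) => ab.
    by apply/max_idPr; rewrite lerXn2r.
  by apply/max_idPl; rewrite lerXn2r // ltW.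
apply: tensor_lq_norm_le => // [|i].
  by rewrite exprn_ge0 // le_max a0.
have -> : \sum_k `|(h' - g') (i k) k| = \sum_k `|h' (i k) k - g' (i k) k|.
  by apply: eq_bigr => k _; rewrite !mxE.
rewrite !ffunE.
apply: (prodB_le _ _ (fun k => h' (i k) k) (fun k => g' (i k) k)) => k.
  by rewrite le_max /a -(dh'.2 k) // (sup_norm_ge _ _ (fun s => h' s k)).
by rewrite le_max orbC /b -(dg'.2 k) // (sup_norm_ge _ _ (fun s => g' s k)).
Qed.
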